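(* For $b\in\mathbb{R}$, $k\in\mathbb{Z}\setminus\{b\}$ and $n\in\mathbb{N}$, let $\lambda_{n,k}^b=4n|k-b|$ be the eigenvalues of the Aharonov-Bohm magnetic Laplace-Beltrami operator $-\Delta^b$ on the half Grushin cylinder. Fix $k\in\mathbb{Z}$. Then, for every $n\in\mathbb{N}$, the level spacing satisfies $$|\lambda_{n,k}^b-\lambda_{n-1,k}^b|\to0\quad\text{as } b\to k.$$ Moreover, for any fixed interval $I=[x_1,x_2]\subset[0,\infty)$ with $x_1<x_2$ and any $N\in\mathbb{N}$, one has $$\#\{n\in\mathbb{N}\mid\lambda_{n,k}^b\in I\}\ge N\quad\text{as } b\to k,$$ i.e. for all $b\neq k$ sufficiently close to $k$.
   Context: $\mathbb{N}=\{1,2,3,\dots\}$. The operator $\Delta^b=\partial_x^2-\frac1x\partial_x+|x|^2(\partial_\theta^2-2ib\,\partial_\theta-b^2)$ is the self-adjoint closure of the corresponding operator with domain $C_c^\infty(M_+)$ in $L^2(M_+,\frac1x\,dx\,d\theta)$, $M_+=(0,\infty)\times\mathbb{S}^1$; the set of eigenvalues of $-\Delta^b$ (including embedded ones) is $\{4n|k-b|\mid n\in\mathbb{N},\,k\in\mathbb{Z}\setminus\{b\}\}$. For $n=1$ the symbol $\lambda_{0,k}^b$ is read via the same formula, i.e. $\lambda_{0,k}^b=0$. *)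

(* Defs.v *)
From HB Require Import structures.
From mathcomp Require Import all_boot all_order all_algebra.
From mathcomp Require Import all_classical all_reals all_analysis.

Set Implicit Arguments.
Unset Strict Implicit.
Unset Printing Implicit Defensive.
Import Order.TTheory GRing.Theory Num.Theory.
Import numFieldNormedType.Exports.

Local Open Scope ring_scope.

(* On L^2((0,oo) x S^1, dx dtheta / x), the operator - Delta^b, where
     Delta^b = d_x^2 - (1/x) d_x + |x|^2 (d_theta^2 - 2 i b d_theta - b^2),
   has eigenvalue set { AB_eigenvalue b k n | k <> b, n >= 1 }.
   Here n : nat starts at 0: AB_eigenvalue b k 0 = 0 only serves as the
   predecessor of the first level AB_eigenvalue b k 1. *)
Definition AB_eigenvalue (R : realType) (b : R) (k : int) (n : nat) : R :=
  4 * n%:R * `|k%:~R - b|.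

(* Main.v *)
Require Import Defs.
From HB Require Import structures.
From mathcomp Require Import all_boot all_order all_algebra.
From mathcomp Require Import all_classical all_reals all_analysis.
From mathcomp Require Import lra.
Import Order.TTheory GRing.Theory Num.Theory.
Import numFieldNormedType.Exports.

Local Open Scope classical_set_scope.
Local Open Scope ring_scope.

(** For fixed [k] the levels are the multiples of the single number [d = 4 * |k - b|], which is
    therefore every gap, whatever [n] is. As [b] tends to [k], [d] tends to 0 ([cvg_AB_gap]), which
    settles the spacing. Once [N * d] is at most the length of the interval, [N] consecutive
    multiples of [d] fit inside it ([card_multiples_itv]). *)

Lemma AB_eigenvalue_multiple (R : realType) (b : R) (k : int) (n : nat) :
  AB_eigenvalue b k n = n%:R * (4 * `|k%:~R - b|).
Proof. by rewrite /AB_eigenvalue -mulrA mulrCA. Qed.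

Lemma AB_gapE (R : realType) (b : R) (k : int) (n : nat) :
  `|AB_eigenvalue b k n.+1 - AB_eigenvalue b k n| = 4 * `|k%:~R - b|.
Proof.
by rewrite !AB_eigenvalue_multiple -mulrBl -natrB// subSnn mul1r ger0_norm//.
Qed.

Lemma cvg_AB_gap (R : realType) (k : int) :
  4 * `|k%:~R - b| @[b --> (k%:~R : R)^'] --> (0 : R).
Proof.
(* With 0 written as the value at [k], the punctured limit becomes continuity at [k]. *)
have -> : (0 : R) = (fun b : R => 4 * `|k%:~R - b|) k%:~R.
  by rewrite /= subrr normr0 mulr0.
apply/continuous_withinNx.
apply: cvgM; first exact: cvg_cst.
by apply: cvg_norm; apply: cvgB; [exact: cvg_cst | exact: cvg_id].
Qed.

(* For m = floor (x1 / d), the N multiples (m+1) d, ..., (m+N) d lie in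
   (x1, x1 + N d]. *)
Lemma card_multiples_itv (R : realType) (d x1 x2 : R) (N : nat) :
  0 < d -> 0 <= x1 -> N%:R * d <= x2 - x1 ->
  (`I_N #<= [set n : nat | (1 <= n)%N /\ n%:R * d \in `[x1, x2]%R])%card.
Proof.
move=> d0 x10 Nd; set m := Num.truncn (x1 / d).
have /andP[mx xm] : m%:R <= x1 / d < m.+1%:R.
  by apply: truncn_itv; rewrite divr_ge0 // ltW.
rewrite ler_pdivlMr// in mx; rewrite ltr_pdivrMr// in xm.
(* Shifting [I_N] by [m.+1] reduces the cardinality bound to an inclusion. *)
have inj : {in `I_N &, injective (addn m.+1)} by move=> i j _ _ /addnI.
rewrite -(card_le_eql (inj_card_eq inj)).
apply: subset_card_le => _ [i /= iN <-]; split; first by rewrite addSn.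
rewrite in_itv /= natrD mulrDl; apply/andP; split.
  by rewrite (le_trans (ltW xm))// lerDl mulr_ge0 // ltW.
(* Upper end: [(m+1+i) d = m d + (i+1) d <= x1 + N d <= x2]. *)
have : i.+1%:R * d <= N%:R * d by rewrite ler_pM2r// ler_nat.
rewrite -!natr1 !mulrDl !mul1r; lra.
Qed.

Theorem corollary2p8 (R : realType) (k : int) :
  (forall n : nat, (1 <= n)%N ->
     `|AB_eigenvalue b k n - AB_eigenvalue b k n.-1|
       @[b --> (k%:~R : R)^'] --> (0 : R)) /\
  (forall (x1 x2 : R) (N : nat), 0 <= x1 -> x1 < x2 -> (1 <= N)%N ->
     \forall b \near (k%:~R : R)^',
       (`I_N #<= [set n : nat | (1 <= n)%N /\
                                AB_eigenvalue b k n \in `[x1, x2]%R])%card).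
Proof.
split=> [[//|n] _ | x1 x2 N x10 x12 N1].
  under eq_cvg do rewrite AB_gapE.
  exact: cvg_AB_gap.
have N0 : 0 < N%:R :> R by rewrite ltr0n.
have e0 : 0 < (x2 - x1) / N%:R by rewrite divr_gt0// subr_gt0.
near=> b.
(* The puncture matters here: at [b = k] all levels collapse to 0. *)
have d0 : 0 < 4 * `|k%:~R - b|.
  rewrite mulr_gt0// normr_gt0 subr_eq0 eq_sym.
  by near: b; exact: nbhs_dnbhs_neq.
(* This threshold makes [N] gaps fit into the interval. *)
have dN : 4 * `|k%:~R - b| <= (x2 - x1) / N%:R.
  by near: b; exact: (cvgr_le _ (cvg_AB_gap R k)).
rewrite ler_pdivlMr// mulrC in dN.
under [X in (_ #<= X)%card]eq_set do rewrite AB_eigenvalue_multiple.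
exact: card_multiples_itv.
Unshelve. all: by end_near.
Qed.
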